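(* Let $f$ be a $C^1$ symplectic twist diffeomorphism of $\mathbb A=\mathbb T\times\mathbb R$. Then there exists a continuous map $u:\mathbb T\times\mathbb R\to\mathbb R$ such that, writing $u_c=u(\cdot,c)$: (i) $u(0,c)=0$ for every $c\in\mathbb R$; (ii) for every $c\in\mathbb R$, $u_c$ is a weak K.A.M. solution for the cohomology class $c$; this implies that each $u_c$ is semi-concave (hence differentiable almost everywhere) and that each partial graph $\mathcal G(c+u_c')$ is backward invariant by $f$, i.e. $f^{-1}\big(\mathcal G(c+u_c')\big)\subset\mathcal G(c+u_c')$.
   Context: $\mathbb T=\mathbb R/\mathbb Z$, $\mathbb A=\mathbb T\times\mathbb R$ with coordinates $(\theta,r)$. Symplectic twist map (or diffeomorphism): a $C^1$ diffeomorphism $f:\mathbb A\to\mathbb A$ that is isotopic to the identity; exact symplectic, i.e. if $f(\theta,r)=(\Theta,R)$ then the 1-form $R\,d\Theta-r\,d\theta$ is exact; and has the twist property: for any lift $F=(F_1,F_2):\mathbb R^2\to\mathbb R^2$ of $f$ and any $\tilde\theta\in\mathbb R$, the map $r\mapsto F_1(\tilde\theta,r)$ is an increasing $C^1$ diffeomorphism from $\mathbb R$ onto $\mathbb R$. Generating function: fix a lift $F$ of $f$. A $C^2$ function $S:\mathbb R^2\to\mathbb R$ is a generating function of $F$ if $S(\theta+1,\Theta+1)=S(\theta,\Theta)$; $S(\theta,\Theta)/|\Theta-\theta|\to+\infty$ as $|\Theta-\theta|\to\infty$; for all $\theta_0,\Theta_0$ the maps $\theta\mapsto\frac{\partial S}{\partial\Theta}(\theta,\Theta_0)$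 and $\Theta\mapsto\frac{\partial S}{\partial\theta}(\theta_0,\Theta)$ are decreasing diffeomorphisms of $\mathbb R$; and $F(\theta,r)=(\Theta,R)\Leftrightarrow r=-\frac{\partial S}{\partial\theta}(\theta,\Theta)$ and $R=\frac{\partial S}{\partial\Theta}(\theta,\Theta)$. Every lift of a symplectic twist map has such an $S$; fix one. Weak K.A.M. solutions: for $c\in\mathbb R$ there is a unique $\alpha(c)\in\mathbb R$ for which there exists $u\in C^0(\mathbb T,\mathbb R)$ whose lift $\tilde u:\mathbb R\to\mathbb R$ satisfies, for all $\theta\in\mathbb R$, $\tilde u(\theta)=\inf_{\theta'\in\mathbb R}\big(\tilde u(\theta')+S(\theta',\theta)+c(\theta'-\theta)+\alpha(c)\big)$. Any such $u$ is called a weak K.A.M. solution for the cohomology class $c$. Semi-concavity: $v:\mathbb R\to\mathbb R$ is $K$-semi-concave ($K>0$) if for every $x$ there is $p\in\mathbb R$ with $v(y)-v(x)-p(y-x)\le\frac K2(y-x)^2$ for all $y\in\mathbb R$; a function on $\mathbb T$ is $K$-semi-concave if its lift is; semi-concave means $K$-semi-concave for some $K$. $\mathcal G(c+u')=\{(\theta,c+u'(\theta)):\ u \text{ is differentiable at }\theta\}$ is the partial graph. *)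

(* Defs.v *)
From HB Require Import structures.
From mathcomp Require Import all_boot all_order all_algebra.
From mathcomp Require Import all_classical all_reals all_analysis.
Set Implicit Arguments.
Unset Strict Implicit.
Unset Printing Implicit Defensive.
Import Order.TTheory GRing.Theory Num.Theory.
Import numFieldNormedType.Exports.
Local Open Scope classical_set_scope.
Local Open Scope quotient_scope.
Local Open Scope ring_scope.

Definition Zcongr (R : realType) : rel R := fun x y => x - y \is a Num.int.

Lemma Zcongr_refl (R : realType) : reflexive (@Zcongr R).
Proof. by move=> x; rewrite /Zcongr subrr rpred0. Qed.

Lemma Zcongr_sym (R : realType) : symmetric (@Zcongr R).
Proof. by move=> x y; rewrite /Zcongr -opprB rpredN. Qed.

Lemma Zcongr_trans (R : realType) : transitive (@Zcongr R).
Proof.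
by move=> y x z xy yz; rewrite /Zcongr -(subrKA y) rpredD.
Qed.

Canonical Zcongr_equiv (R : realType) : equiv_rel R :=
  EquivRel (@Zcongr R) (@Zcongr_refl R) (@Zcongr_sym R) (@Zcongr_trans R).

Definition circle (R : realType) : topologicalType :=
  quotient_topology {eq_quot (@Zcongr_equiv R)}.

Definition circle_pi (R : realType) (x : R) : circle R :=
  (\pi_{eq_quot (@Zcongr_equiv R)} x)%qT.

Lemma circle_piP (R : realType) (x y : R) :
  circle_pi x = circle_pi y <-> x - y \is a Num.int.
Proof. by split=> [/eqmodP|h]; [|apply/eqmodP]. Qed.

Definition annulus (R : realType) : topologicalType := (circle R * R)%type.

Definition annulus_pi (R : realType) (p : R * R) : annulus R :=
  (circle_pi p.1, p.2).

Definition C1 (R : realType) (U V : normedModType R) (g : U -> V) : Prop :=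
  (forall x, differentiable g x) /\ forall v, continuous (fun x => 'd g x v).

Definition C2 (R : realType) (U V : normedModType R) (g : U -> V) : Prop :=
  C1 g /\ forall v, C1 (fun x => 'd g x v : V).

Definition C1_diffeo (R : realType) (g : R -> R) : Prop :=
  C1 g /\ exists h : R -> R, [/\ cancel g h, cancel h g & C1 h].

Definition homeomorphism (X Y : topologicalType) (g : X -> Y) : Prop :=
  continuous g /\
  exists h : Y -> X, [/\ cancel g h, cancel h g & continuous h].

Definition is_lift (R : realType) (f : annulus R -> annulus R)
    (F : R * R -> R * R) : Prop :=
  continuous F /\ forall p, annulus_pi (F p) = f (annulus_pi p).

(* The smooth structure of the annulus is the one making [annulus_pi] a local
   diffeomorphism; since R * R is simply connected, f is C^1 for it exactly
   when f has a C^1 lift. *)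
Definition annulus_C1 (R : realType) (f : annulus R -> annulus R) : Prop :=
  exists2 F, is_lift f F & C1 F.

Definition annulus_C1_diffeo (R : realType) (f : annulus R -> annulus R) :
    Prop :=
  annulus_C1 f /\
  exists g : annulus R -> annulus R,
    [/\ cancel f g, cancel g f & annulus_C1 g].

(* Isotopy through homeomorphisms: among the usual meanings of "isotopic" this
   is the least restrictive one. *)
Definition isotopic_to_id (R : realType) (X : topologicalType) (f : X -> X) :
    Prop :=
  exists H : R * X -> X,
    [/\ {within [set tx : R * X | 0 <= tx.1 <= 1], continuous H},
        forall t : R, 0 <= t <= 1 -> homeomorphism (fun x => H (t, x)),
        forall x, H (0, x) = x
      & forall x, H (1, x) = f x].

(* R dTheta - r dtheta = dA on the annulus. The identity is pulled back to
   R * R: there Theta and R become the components of a lift F, (theta, r)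
   becomes p, and v is the tangent vector on which the forms are evaluated. *)
Definition exact_symplectic (R : realType) (f : annulus R -> annulus R) :
    Prop :=
  forall F : R * R -> R * R, is_lift f F ->
  exists2 A : annulus R -> R, C1 (A \o @annulus_pi R) &
    forall p v : R * R,
      'd (A \o @annulus_pi R) p v =
      (F p).2 * 'd (fun q => (F q).1) p v - p.2 * v.1.

Definition twist_property (R : realType) (f : annulus R -> annulus R) : Prop :=
  forall F : R * R -> R * R, is_lift f F -> forall theta : R,
    {homo (fun r : R => (F (theta, r)).1) : x y / x < y} /\
    C1_diffeo (fun r : R => (F (theta, r)).1).

Record symplectic_twist (R : realType) (f : annulus R -> annulus R) : Prop :=
  SymplecticTwist {
    st_diffeo : annulus_C1_diffeo f ;
    st_isotopic : isotopic_to_id R f ;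
    st_exact : exact_symplectic f ;
    st_twist : twist_property f }.

Definition partial1 (R : realType) (S : R * R -> R) (theta Theta : R) : R :=
  derive1 (fun t : R => S (t, Theta)) theta.

Definition partial2 (R : realType) (S : R * R -> R) (theta Theta : R) : R :=
  derive1 (fun t : R => S (theta, t)) Theta.

Record generating_function (R : realType) (F : R * R -> R * R)
    (S : R * R -> R) : Prop := GeneratingFunction {
  gf_C2 : C2 S ;
  gf_periodic : forall theta Theta, S (theta + 1, Theta + 1) = S (theta, Theta) ;
  gf_superlinear : forall M : R, exists B : R, forall theta Theta,
    B < `|Theta - theta| -> M <= S (theta, Theta) / `|Theta - theta| ;
  gf_partial2_diffeo : forall Theta0,
    {homo (fun theta => partial2 S theta Theta0) : x y / x < y >-> y < x} /\
    C1_diffeo (fun theta => partial2 S theta Theta0) ;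
  gf_partial1_diffeo : forall theta0,
    {homo (fun Theta => partial1 S theta0 Theta) : x y / x < y >-> y < x} /\
    C1_diffeo (fun Theta => partial1 S theta0 Theta) ;
  gf_generates : forall theta r Theta r',
    F (theta, r) = (Theta, r') <->
    r = - partial1 S theta Theta /\ r' = partial2 S theta Theta }.

Definition circle_lift (R : realType) (v : circle R -> R) : R -> R :=
  fun x => v (circle_pi x).

(* The infimum is taken in the extended reals, so that an infimum over a set
   that is not bounded below is -oo and not a default real value. *)
Definition weak_KAM_equation (R : realType) (S : R * R -> R) (c a : R)
    (v : circle R -> R) : Prop :=
  continuous v /\
  forall theta : R,
    (circle_lift v theta)%:E =
    ereal_inf (range (fun theta' : R =>
      (circle_lift v theta' + S (theta', theta) + c * (theta' - theta) + a)%:E)).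

(* a is alpha(c) *)
Definition is_alpha (R : realType) (S : R * R -> R) (c a : R) : Prop :=
  unique (fun a' => exists v, weak_KAM_equation S c a' v) a.

Definition weak_KAM_solution (R : realType) (S : R * R -> R) (c : R)
    (v : circle R -> R) : Prop :=
  exists2 a, is_alpha S c a & weak_KAM_equation S c a v.

Definition semiconcave_with (R : realType) (K : R) (w : R -> R) : Prop :=
  forall x, exists p, forall y,
    w y - w x - p * (y - x) <= K / 2 * (y - x) ^+ 2.

Definition circle_semiconcave (R : realType) (v : circle R -> R) : Prop :=
  exists2 K : R, 0 < K & semiconcave_with K (circle_lift v).

(* A subset of the circle is Lebesgue-null iff its preimage in R is. *)
Definition circle_ae_differentiable (R : realType) (v : circle R -> R) : Prop :=
  {ae @lebesgue_measure R, forall x, derivable (circle_lift v) x 1}.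

Definition partial_graph (R : realType) (c : R) (v : circle R -> R) :
    set (annulus R) :=
  [set p | exists2 x : R, derivable (circle_lift v) x 1 &
             p = (circle_pi x, c + derive1 (circle_lift v) x)].

(* Main.v *)
Require Import Defs.
From mathcomp Require Import all_boot all_order all_algebra.
From mathcomp Require Import all_classical all_reals all_analysis.
From mathcomp Require Import ring lra.
Import Order.TTheory GRing.Theory Num.Theory.
Import numFieldNormedType.Exports.
Local Open Scope classical_set_scope.
Local Open Scope ring_scope.
Set Implicit Arguments.
Unset Strict Implicit.
Unset Printing Implicit Defensive.

(* Consider, for 0 <= b < 1, the discounted Lax-Oleinik operator
     (T_{b,c} w)(x) = inf_t (b w(t) + S(t,x) + c (t - x)).
   By the twist condition S is submodular, so Aubry's crossing argument shows
   that T_{b,c} preserves the vertical order "c x + w(x) - (c' x + w'(x)) is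
   nonincreasing in x" between w at class c and w' at class c' >= c. Iterating
   from w = 0 produces, for b < 1, functions that are almost fixed by T_{b,c},
   equi-Lipschitz, and vertically ordered with respect to c. Normalize them to
   vanish at 0 and take a limit as b tends to 1 along one ultrafilter, the same
   for all (x, c): the limits u_c solve the weak K.A.M. equation and are still
   vertically ordered. For 1-periodic functions vanishing at 0 the order
   forces |u_c - u_{c'}| <= |c - c'|, hence joint continuity. *)

(** * Submodular costs and the discounted Lax-Oleinik operator *)

(** All that the construction of the ordered solutions asks of a generating function. *)
Record cost (R : realType) (s : R -> R -> R) : Prop := Cost {
  cost_periodic : forall t x, s (t + 1) (x + 1) = s t x ;
  cost_submodular : forall t t' x x', t <= t' -> x <= x' ->
    s t x + s t' x' <= s t x' + s t' x ;
  cost_bounded : forall B, exists C, forall t x, `|x - t| <= B -> `|s t x| <= C ;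
  cost_lipschitz : forall B, exists2 L, 0 <= L & forall t x y,
    `|x - t| <= B -> `|y - t| <= B -> `|s t y - s t x| <= L * `|y - x| ;
  cost_superlinear : forall M, exists B, forall t x,
    B < `|x - t| -> M * `|x - t| <= s t x ;
  cost_continuous : forall x, continuous (s^~ x) }.

Section PeriodicFunctions.
Context {R : realType}.
Implicit Types w : R -> R.

Definition periodic1 w := forall x, w (x + 1) = w x.

Lemma periodic1_int w (k : int) x : periodic1 w -> w (x + k%:~R) = w x.
Proof.
move=> pw; have H (n : nat) y : w (y + n%:R) = w y.
  by elim: n y => [|n IH] y; rewrite ?addr0// -natr1 addrA pw.
case: k => n; first exact: H.
by rewrite NegzE mulrNz -(H n.+1) subrK.
Qed.

Lemma int_translate (x t : R) : exists k : int, 0 <= t + k%:~R - x < 1.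
Proof.
exists (- Num.floor (t - x)); have := floor_itv (t - x).
rewrite intrD mulr1z mulrNz => /andP[]; lra.
Qed.

End PeriodicFunctions.

Section DiscountedLaxOleinik.
Context {R : realType} (s : R -> R -> R) (s_cost : cost s).
Implicit Types (w v : R -> R) (b c t x y : R).

Definition action b c w t x := b * w t + s t x + c * (t - x).

(** The real [inf] has a default value on a set unbounded below; [action_has_inf] excludes this case
    for bounded [w] and [0 <= b]. *)
Definition lax_oleinik b c w x := inf (range (fun t => action b c w t x)).

(** Superlinearity with slope [|c|] absorbs the linear term far from the diagonal; on the remaining
    strip the cost is bounded. *)
Lemma tilted_cost_bound c : exists2 m, 0 <= m &
  (forall t x, - m <= s t x + c * (t - x)) /\ (forall x, s x x <= m).
Proof.
have [B HB] := cost_superlinear s_cost `|c|.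
have [C HC] := cost_bounded s_cost (`|B|).
have C0 : 0 <= C by apply: le_trans (HC 0 0 _); rewrite // subrr normr0.
exists (C + `|c| * `|B|); first by rewrite addr_ge0// mulr_ge0.
split=> [t x|x]; last first.
  apply: le_trans (ler_norm _) _; apply: le_trans (HC x x _) _.
    by rewrite subrr normr0.
  by rewrite lerDl mulr_ge0.
have cx : - (`|c| * `|x - t|) <= c * (t - x).
  by rewrite distrC -normrM lerNl -normrN ler_norm.
have [Bx|xB] := ltP B `|x - t|.
  by have := HB _ _ Bx; have := mulr_ge0 (normr_ge0 c) (normr_ge0 B); lra.
have xB' : `|x - t| <= `|B| by apply: le_trans xB (ler_norm _).
have := HC _ _ xB'; rewrite ler_norml => /andP[? _].
by have := ler_wpM2l (normr_ge0 c) xB'; lra.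
Qed.

(* Translating [t] by an integer leaves [w t] unchanged and brings [t] within
   distance 1 of [x]; superlinearity makes this an improvement when [t] was far. *)
Lemma action_confined c : exists2 B, 0 <= B & forall b w t x, periodic1 w ->
  exists2 t', `|x - t'| <= B & action b c w t' x <= action b c w t x.
Proof.
have [C HC] := cost_bounded s_cost 1.
have C0 : 0 <= C by apply: le_trans (HC 0 0 _); rewrite // subrr normr0.
(* The action at the translate exceeds [b * w t] by at most [C + |c|]; the second [|c|] in the slope
   absorbs the linear term at [t]. *)
have [B HB] := cost_superlinear s_cost (C + `|c| *+ 2).
exists (`|B| + 1) => // b w t x pw.
have [xB|Bx] := leP `|x - t| (`|B| + 1); first by exists t.
have [k /andP[k0 k1]] := int_translate x t.
have kx : `|x - (t + k%:~R)| <= 1 by rewrite ler_norml; apply/andP; split; lra.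
exists (t + k%:~R); first by apply: le_trans kx _; rewrite lerDr.
rewrite /action periodic1_int// -!addrA lerD2l.
have := HC _ _ kx; rewrite ler_norml => /andP[_ Sk].
have ck : c * (t + k%:~R - x) <= `|c|.
  apply: le_trans (ler_norm _) _; rewrite normrM -[leRHS]mulr1 ler_wpM2l//.
  by rewrite distrC.
have St : (C + `|c| *+ 2) * `|x - t| <= s t x.
  by apply: HB; apply: le_lt_trans Bx; have := ler_norm B; lra.
have ct : - (`|c| * `|x - t|) <= c * (t - x).
  by rewrite distrC -normrM lerNl -normrN ler_norm.
have x1 : 1 <= `|x - t| by apply: le_trans (ltW Bx); rewrite lerDr.
have : (C + `|c|) * 1 <= (C + `|c|) * `|x - t|.
  by rewrite ler_wpM2l// addr_ge0.
rewrite !addrA; lra.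
Qed.

Section Operator.
Context {b c : R} (b0 : 0 <= b).

Section Bounded.
Context {w : R -> R} {N : R} (wN : forall t, `|w t| <= N).

Lemma action_has_inf x : has_inf (range (fun t => action b c w t x)).
Proof.
have [m m0 [Hm _]] := tilted_cost_bound c.
split; first by exists (action b c w 0 x), 0.
exists (- (b * N) - m) => _ [t _ <-]; rewrite /action.
have := Hm t x; have : b * - N <= b * w t.
  by rewrite ler_wpM2l//; have := wN t; rewrite ler_norml => /andP[].
lra.
Qed.

Lemma lax_oleinik_le t x : lax_oleinik b c w x <= action b c w t x.
Proof. by apply: ge_inf; [case: (action_has_inf x)|exists t]. Qed.

Lemma lax_oleinik_approx x e : 0 < e ->
  exists t, action b c w t x <= lax_oleinik b c w x + e.
Proof.
by move=> e0; have [_ [t _ <-] /ltW] := inf_adherent e0 (action_has_inf x); exists t.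
Qed.

End Bounded.

Lemma lax_oleinik_ge w x z : (forall t, z <= action b c w t x) ->
  z <= lax_oleinik b c w x.
Proof.
move=> H; apply: lb_le_inf; first by exists (action b c w 0 x), 0.
by move=> _ [t _ <-].
Qed.

Lemma lax_oleinik_periodic w : periodic1 w -> periodic1 (lax_oleinik b c w).
Proof.
move=> pw x; rewrite /lax_oleinik; congr inf; apply/seteqP; split=> _ [t _ <-].
  exists (t - 1) => //; rewrite /action -(pw (t - 1)).
  by rewrite -(cost_periodic s_cost (t - 1) x) subrK; congr (_ + _ * _); lra.
exists (t + 1) => //; rewrite /action pw (cost_periodic s_cost).
by congr (_ + _ * _); lra.
Qed.

End Operator.

Lemma lax_oleinik_bounded c : exists2 m, 0 <= m & forall b w N, 0 <= b ->
  (forall t, `|w t| <= N) -> forall x, `|lax_oleinik b c w x| <= b * N + m.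
Proof.
have [m m0 [Hm Hm']] := tilted_cost_bound c.
exists m => // b w N b0 wN x.
have bw t : - (b * N) <= b * w t <= b * N.
  by rewrite -mulrN !ler_wpM2l//; have := wN t; rewrite ler_norml => /andP[].
rewrite ler_norml; apply/andP; split.
  apply: lax_oleinik_ge => t; rewrite /action; have := Hm t x.
  by have /andP[] := bw t; lra.
apply: le_trans (lax_oleinik_le b0 wN x x) _.
by rewrite /action subrr mulr0; have := Hm' x; have /andP[] := bw x; lra.
Qed.

Lemma lax_oleinik_contraction b c w v N e : 0 <= b ->
  (forall t, `|w t| <= N) -> (forall t, `|v t| <= N) ->
  (forall t, `|w t - v t| <= e) ->
  forall x, `|lax_oleinik b c w x - lax_oleinik b c v x| <= b * e.
Proof.
move=> b0.
suff H u u' x : (forall t, `|u t| <= N) -> (forall t, `|u t - u' t| <= e) ->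
    lax_oleinik b c u x <= lax_oleinik b c u' x + b * e.
  move=> wN vN wv x; rewrite ler_norml.
  have vw t : `|v t - w t| <= e by rewrite distrC.
  by have := H _ _ x wN wv; have := H _ _ x vN vw => ? ?; apply/andP; split; lra.
move=> uN uu'; rewrite -lerBlDr; apply: lax_oleinik_ge => t.
have := lax_oleinik_le (c := c) b0 uN t x; rewrite /action.
have : b * (u t - u' t) <= b * e.
  by rewrite ler_wpM2l//; have := uu' t; rewrite ler_norml => /andP[].
lra.
Qed.

(** A competitor at [x] is confined near [x], then tested at [y]; only [c] and the cost on a strip
    enter, so [L] is uniform in [b] and [w]. *)
Lemma lax_oleinik_lipschitz c : exists2 L, 0 <= L & forall b w N, 0 <= b ->
  periodic1 w -> (forall t, `|w t| <= N) ->
  forall x y, `|lax_oleinik b c w y - lax_oleinik b c w x| <= L * `|y - x|.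
Proof.
have [B B0 HB] := action_confined c.
have [L L0 HL] := cost_lipschitz s_cost (B + 1).
exists (L + `|c|) => [|b w N b0 pw wN]; first by rewrite addr_ge0.
have loc x y : `|y - x| <= 1 ->
    lax_oleinik b c w y <= lax_oleinik b c w x + (L + `|c|) * `|y - x|.
  move=> yx; rewrite -lerBlDr; apply: lax_oleinik_ge => t.
  have [t' xt'] := HB b w t x pw; apply: le_trans.
  have := lax_oleinik_le (c := c) b0 wN t' y; rewrite /action.
  have xt1 : `|x - t'| <= B + 1 by apply: le_trans xt' _; rewrite lerDl.
  have yt1 : `|y - t'| <= B + 1.
    rewrite (_ : y - t' = (x - t') + (y - x)); last by lra.
    by apply: le_trans (ler_normD _ _) _; rewrite lerD.
  have := HL _ _ _ xt1 yt1; rewrite ler_norml => /andP[_].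
  have : c * (x - y) <= `|c| * `|y - x|.
    by rewrite distrC -normrM ler_norm.
  lra.
have loc2 x y : `|y - x| <= 1 ->
    `|lax_oleinik b c w y - lax_oleinik b c w x| <= (L + `|c|) * `|y - x|.
  move=> yx; rewrite ler_norml; have := loc x y yx.
  by have := loc y x; rewrite distrC => /(_ yx) ? ?; apply/andP; split; lra.
move=> x y; have [/loc2//|yx] := leP `|y - x| 1.
have [k /andP[k0 k1]] := int_translate x y.
have kx : `|y + k%:~R - x| <= 1 by rewrite ger0_norm// ltW.
rewrite -(periodic1_int k _ (lax_oleinik_periodic pw)).
apply: le_trans (loc2 _ _ kx) _; rewrite ler_wpM2l ?addr_ge0//.
exact: le_trans kx (ltW yx).
Qed.

(** Between differentiable functions it puts the graph of [c + w'] below that of [c' + v']. *)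
Definition vertically_ordered c w c' v := forall x y, x <= y ->
  w y - w x + c * (y - x) <= v y - v x + c' * (y - x).

(* Aubry's crossing argument: near-minimizers [t] for [w] at [x] and [t'] for
   [v] at [y] are either exchanged using the order of [w] and [v] (when
   [t <= t']) or using the submodularity of the cost (when [t' <= t]). *)
Lemma lax_oleinik_ordered b c c' w v N : 0 <= b <= 1 -> c <= c' ->
  (forall t, `|w t| <= N) -> (forall t, `|v t| <= N) ->
  vertically_ordered c w c' v ->
  vertically_ordered c (lax_oleinik b c w) c' (lax_oleinik b c' v).
Proof.
move=> /andP[b0 b1] cc' wN vN wv x y xy; apply/ler_addgt0Pr => e e0.
have e2 : 0 < e / 2 by lra.
have [t Ht] := lax_oleinik_approx (c := c) b0 wN x e2.
have [t' Ht'] := lax_oleinik_approx (c := c') b0 vN y e2.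
move: Ht Ht'; rewrite /action.
have [tt'|/ltW t't] := leP t t'.
- have := lax_oleinik_le (c := c) b0 wN t' y.
  have := lax_oleinik_le (c := c') b0 vN t x.
  rewrite /action; have := ler_wpM2l b0 (wv _ _ tt').
  (* Only the values of [w] and [v] are discounted: the order scaled by [b] leaves this share of the
     linear terms, settled by [c <= c']. *)
  have : (1 - b) * (c * (t' - t)) <= (1 - b) * (c' * (t' - t)).
    by rewrite ler_wpM2l ?subr_ge0// ler_wpM2r ?subr_ge0//.
  lra.
- have := lax_oleinik_le (c := c) b0 wN t y.
  have := lax_oleinik_le (c := c') b0 vN t' x.
  rewrite /action; have := cost_submodular s_cost t't xy.
  lra.
Qed.


(** * Iterates of the discounted operator *)

Definition iterate b c n : R -> R := iter n (lax_oleinik b c) (fun=> 0).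

Lemma iterate_periodic b c n : periodic1 (iterate b c n).
Proof. by elim: n => [//|n IH]; apply: lax_oleinik_periodic. Qed.

(** [m / (1 - b)] is the fixed point of [N |-> b * N + m], the bound that one application of the
    operator gives. *)
Lemma iterate_bounded c : exists2 m, 0 <= m & forall b n x, 0 <= b < 1 ->
  `|iterate b c n x| <= m / (1 - b).
Proof.
have [m m0 Hm] := lax_oleinik_bounded c.
exists m => // b n + /andP[b0 b1]; have b1' : 0 < 1 - b by rewrite subr_gt0.
elim: n => [|n IH] x /=; first by rewrite normr0 divr_ge0// ltW.
apply: le_trans (Hm b _ _ b0 IH x) _.
have -> : b * (m / (1 - b)) + m = m / (1 - b) by field; rewrite gt_eqF.
by [].
Qed.

(** The first step is bounded by [m] and each application contracts by [b], so high iterates are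
    almost fixed. *)
Lemma iterate_step c : exists2 m, 0 <= m & forall b n x, 0 <= b < 1 ->
  `|iterate b c n x - iterate b c n.+1 x| <= b ^+ n * m.
Proof.
have [m m0 Hm] := lax_oleinik_bounded c.
have [m' _ Hm'] := iterate_bounded c.
exists m => // b n + bb; have /andP[b0 b1] := bb.
elim: n => [|n IH] x.
  rewrite expr0 mul1r sub0r normrN.
  by have := Hm b (fun=> 0) 0 b0 _ x; rewrite mulr0 add0r; apply=> ?; rewrite normr0.
rewrite exprS -mulrA; have bd k t : `|iterate b c k t| <= m' / (1 - b) by apply: Hm'.
exact: (lax_oleinik_contraction c b0 (bd n) (bd n.+1) IH x).
Qed.

Lemma iterate_ordered b c c' n : 0 <= b < 1 -> c <= c' ->
  vertically_ordered c (iterate b c n) c' (iterate b c' n).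
Proof.
move=> bb cc'; have /andP[b0 b1] := bb.
have [m _ Hm] := iterate_bounded c; have [m' _ Hm'] := iterate_bounded c'.
elim: n => [|n IH].
  by move=> x y xy; rewrite /= !subrr !add0r ler_wpM2r// subr_ge0.
apply: (@lax_oleinik_ordered _ _ _ _ _ (Num.max (m / (1 - b)) (m' / (1 - b)))) IH => //.
- by rewrite b0 ltW.
- by move=> t; rewrite le_max Hm.
- by move=> t; rewrite le_max Hm' ?orbT.
Qed.

(* The dependence of the index on [k] only, and not on [c], is what keeps the
   approximate solutions of all cohomology classes ordered. *)
Lemma approximate_solutions : exists (V : nat -> R -> R -> R) (A : nat -> R -> R),
  [/\ forall k c, V k c 0 = 0 /\ periodic1 (V k c),
      forall k c c', c <= c' -> vertically_ordered c (V k c) c' (V k c')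
    & forall c, exists L m B E : R,
      [/\ forall k x y, `|V k c y - V k c x| <= L * `|y - x|,
          forall k, `|A k c| <= m,
          forall k t x, V k c x <= action 1 c (V k c) t x + A k c + E / k.+1%:R
        & forall k x, exists2 t, `|x - t| <= B &
            action 1 c (V k c) t x + A k c <= V k c x + E / k.+1%:R]].
Proof.
pose b k : R := k%:R / k.+1%:R.
have k1 k : 0 < k.+1%:R :> R by rewrite ltr0n.
have b1 k : 1 - b k = k.+1%:R^-1.
  by rewrite /b -[X in X - _](divff (lt0r_neq0 (k1 k))) -mulrBl -natrB// subSnn mul1r.
have bb k : 0 <= b k < 1.
  by rewrite divr_ge0//= -subr_gt0 b1 invr_gt0.
(* Enough iterations for an error of order [1 / k.+1], and at least one, so that [U k c] is an image
   of the operator and inherits its Lipschitz bound. *)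
have /boolp.choice[n Hn] k : exists p : nat, b k ^+ p <= k.+1%:R^-1 /\ (0 < p)%N.
  have : (fun n => b k ^+ n) @ \oo --> (0 : R).
    by apply: cvg_expr; have /andP[? ?] := bb k; rewrite ger0_norm.
  have k1' : 0 < k.+1%:R^-1 :> R by rewrite invr_gt0.
  move=> /cvgr0Pnorm_le /(_ _ k1') [N _ HN].
  exists (maxn N 1); split; last by rewrite leq_max orbT.
  apply: le_trans (ler_norm _) _; apply: HN => /=; exact: leq_maxl.
pose U k c := iterate (b k) c (n k).
(* The operator discounts the subtracted constant [U k c 0], which leaves [- ((1 - b k) * U k c 0)]
   over; this approximates [alpha(c)]. *)
exists (fun k c x => U k c x - U k c 0), (fun k c => - ((1 - b k) * U k c 0)).
split=> [k c|k c c' cc'|c].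
- by rewrite subrr; split=> // x; rewrite /U iterate_periodic.
- move=> x y xy; have := iterate_ordered (n k) (bb k) cc' xy.
  rewrite -/(U k c) -/(U k c'); lra.
have [L L0 HL] := lax_oleinik_lipschitz c.
have [m m0 Hm] := iterate_bounded c.
have [m' m'0 Hm'] := iterate_step c.
have [B B0 HB] := action_confined c.
have UL k x y : `|U k c y - U k c x| <= L * `|y - x|.
  rewrite /U; have [_] := Hn k; case: (n k) => // p _ /=.
  apply: (HL _ _ (m / (1 - b k)) _ (@iterate_periodic _ _ _)) => [|t]; last exact: Hm.
  by case/andP: (bb k).
(* The bound on [U k c] grows with [k], but periodicity keeps its variation at most [L]. *)
have V1 k x : `|U k c x - U k c 0| <= L.
  have [j /andP[j0 j1]] := int_translate 0 x.
  have -> : U k c x = U k c (x + j%:~R).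
    by rewrite periodic1_int//; apply: iterate_periodic.
  apply: le_trans (UL _ _ _) _; rewrite -[leRHS]mulr1 ler_wpM2l//.
  by rewrite ger0_norm// ltW.
have V2 k x : `|(1 - b k) * (U k c x - U k c 0)| <= L / k.+1%:R.
  by rewrite b1 normrM [X in X * _]ger0_norm ?invr_ge0// mulrC ler_wpM2r ?invr_ge0.
have Ub k t : `|U k c t| <= m / (1 - b k) by apply: Hm.
have Ustep k x : `|U k c x - lax_oleinik (b k) c (U k c) x| <= m' / k.+1%:R.
  apply: le_trans (Hm' _ (n k) x (bb k)) _.
  by rewrite mulrC ler_wpM2l//; case: (Hn k).
(* In the last constant, [m'] pays for the almost fixed point, [L] for replacing the discount by 1,
   and 1 for the almost minimizer. *)
exists L, m, B, (m' + L + 1); split=> [k x y|k|k t x|k x].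
- by rewrite (_ : _ - _ = U k c y - U k c x)//; lra.
- rewrite normrN normrM b1 [X in X * _]ger0_norm ?invr_ge0// mulrC ler_pdivrMr//.
  by have := Ub k 0; rewrite b1 invrK.
- have /andP[b0 _] := bb k.
  have := lax_oleinik_le (c := c) b0 (Ub k) t x.
  have := Ustep k x; have := V2 k t; rewrite !ler_norml /action.
  have : 0 <= 1 / k.+1%:R :> R by rewrite divr_ge0.
  move: (k.+1%:R^-1) => q ? /andP[? ?] /andP[? ?] ?; lra.
- have /andP[b0 _] := bb k.
  have e0 : 0 < 1 / k.+1%:R :> R by rewrite divr_gt0.
  have [t' Ht'] := lax_oleinik_approx (c := c) b0 (Ub k) x e0.
  have [t xt Ht] := HB (b k) (U k c) t' x (@iterate_periodic _ _ _).
  exists t => //; move: Ht Ht'.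
  have := Ustep k x; have := V2 k t; rewrite !ler_norml /action.
  move: (k.+1%:R^-1) => q /andP[? ?] /andP[? ?] ? ?; lra.
Qed.

End DiscountedLaxOleinik.

(** * The limit when the discount disappears *)

(** Compactness of the segment gives a cluster point, and an ultrafilter converges to each of its
    cluster points. *)
Lemma ultrafilter_bounded_cvg (R : realType) (G : set_system nat) (u : nat -> R)
    (M : R) : UltraFilter G -> (forall k, `|u k| <= M) -> exists l : R, u @ G --> l.
Proof.
move=> GU uM; have [|l [_ ul]] := @segment_compact R (- M) M (u @ G) _.
  by apply: nearW => k /=; rewrite in_itv/= -ler_norml.
exists l => X Xl; have [//|GX] := in_ultra_setVsetC (u @^-1` X) GU.
by have [y []] := ul _ _ (GX : (u @ G) (~` X)) Xl.
Qed.

(** The weak K.A.M. equation on the line, with its infimum attained. *)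
Definition calibrated (R : realType) (s : R -> R -> R) (c a : R) (w : R -> R) :=
  forall x, (forall t, w x <= action s 1 c w t x + a) /\
    exists t, w x = action s 1 c w t x + a.

(** Inequalities survive pointwise limits; limits of confined almost minimizers provide the attained
    minimum. *)
Lemma ordered_calibrated_solutions (R : realType) (s : R -> R -> R) : cost s ->
  exists (v : R -> R -> R) (a : R -> R),
  [/\ forall c, v c 0 = 0 /\ periodic1 (v c),
      forall c c', c <= c' -> vertically_ordered c (v c) c' (v c'),
      forall c, exists L, forall x y, `|v c y - v c x| <= L * `|y - x|
    & forall c, calibrated s c (a c) (v c)].
Proof.
move=> s_cost; have [V [A [V0 Vord Vc]]] := approximate_solutions s_cost.
(* A single ultrafilter, chosen before [c], keeps the limits of different classes comparable. *)
have [G [GU oG]] : exists G : set_system nat, UltraFilter G /\ \oo `<=` G.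
  exact: ultraFilterLemma.
have Gcvg (u : nat -> R) (l : R) : u @ \oo --> l -> u @ G --> l.
  by move=> ul; apply: cvg_trans ul => X; apply: oG.
have /boolp.choice[v Hv] c : exists v, forall x, (fun k => V k c x) @ G --> (v x : R).
  have [L [m [B [E [HL _ _ _]]]]] := Vc c.
  suff /boolp.choice[v Hv] x : exists l : R, (fun k => V k c x) @ G --> l by exists v.
  apply: (@ultrafilter_bounded_cvg _ _ _ (L * `|x - 0|)) => k.
  by have := HL k 0 x; have [-> _] := V0 k c; rewrite subr0.
have /boolp.choice[a Ha] c : exists l : R, (fun k => A k c) @ G --> l.
  by have [L [m [B [E [_ Hm _ _]]]]] := Vc c; apply: ultrafilter_bounded_cvg Hm.
exists v, a; split=> [c|c c' cc' x y xy|c|c].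
- split=> [|x].
    apply: (norm_cvg_unique (Hv c 0)).
    by apply: cvg_near_cst; apply: nearW => k; case: (V0 k c).
  have := Hv c (x + 1); rewrite (_ : (fun k => _) = (fun k => V k c x)).
    by move=> Hx; apply: (norm_cvg_unique Hx (Hv c x)).
  by apply/funext => k; have [_ ->] := V0 k c.
- apply: (@ler_cvg_to _ G _ _ (fun k => V k c y - V k c x + c * (y - x))
    (fun k => V k c' y - V k c' x + c' * (y - x))).
  + by apply: cvgD (cvg_cst _); apply: cvgB; apply: Hv.
  + by apply: cvgD (cvg_cst _); apply: cvgB; apply: Hv.
  + by apply: nearW => k; apply: Vord.
- have [L [m [B [E [HL _ _ _]]]]] := Vc c; exists L => x y.
  apply: (@ler_cvg_to _ G _ _ (fun k => `|V k c y - V k c x|) (fun=> L * `|y - x|)).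
  + by apply: cvg_norm; apply: cvgB; apply: Hv.
  + exact: cvg_cst.
  + exact: nearW.
have [L [m [B [E [HL _ Hle Hge]]]]] := Vc c.
have E0 : (fun k => E / k.+1%:R) @ G --> (0 : R).
  apply: Gcvg; rewrite -(mulr0 E); apply: cvgM (cvg_cst _) _; exact: cvg_harmonic.
move=> x.
have le t : v c x <= action s 1 c (v c) t x + a c.
  apply: (@ler_cvg_to _ G _ _ (fun k => V k c x)
    (fun k => action s 1 c (V k c) t x + A k c + E / k.+1%:R)).
  + exact: Hv.
  + rewrite -[X in _ --> X]addr0; apply: cvgD E0; apply: cvgD (Ha c).
    apply: cvgD (cvg_cst _); apply: cvgD (cvg_cst _).
    by apply: cvgM (cvg_cst _) _; apply: Hv.
  + exact: nearW.
split=> //.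
have [t0 tt0] : exists t0 : R, (fun k => s2val (cid2 (Hge k x))) @ G --> t0.
  apply: (@ultrafilter_bounded_cvg _ _ _ (B + `|x|)) => k.
  case: cid2 => t xt _ /=.
  rewrite -[t](subKr x); apply: le_trans (ler_normB _ _) _.
  by rewrite addrC lerD2r.
set t := (fun k => _) in tt0.
exists t0; apply/eqP; rewrite eq_le le/=.
(* The equi-Lipschitz bound moves the argument of [V k c] from the varying [t k] to [t0], at a cost
   [L * |t0 - t k|] that tends to 0. *)
apply: (@ler_cvg_to _ G _ _
  (fun k => 1 * V k c t0 + s (t k) x + c * (t k - x) + A k c)
  (fun k => V k c x + E / k.+1%:R + L * `|t0 - t k|)).
- apply: cvgD (Ha c); apply: cvgD; first apply: cvgD.
  + by apply: cvgM (cvg_cst _) _; apply: Hv.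
  + exact: (cvg_comp _ (s^~ x) tt0 (@cost_continuous _ _ s_cost x t0)).
  + by apply: cvgM (cvg_cst _) _; apply: cvgB tt0 (cvg_cst _).
- rewrite -[X in _ --> X]addr0; apply: cvgD.
    by rewrite -[X in _ --> X]addr0; apply: cvgD (Hv c x) E0.
  rewrite -(mulr0 L) -(normr0 R) -(subrr t0); apply: cvgM (cvg_cst _) _.
  by apply: cvg_norm; apply: cvgB (cvg_cst _) tt0.
- apply: nearW => k; rewrite /t; case: cid2 => tk _ /= Hk.
  have := HL k tk t0; rewrite ler_norml => /andP[_].
  by move: Hk; rewrite /action; move: (E / k.+1%:R) (L * _) => e l; lra.
Qed.

(** * Derivatives of a generating function *)

Section Slices.
Context {R : realType}.
Implicit Types (g : R * R -> R) (h : R -> R) (t x y : R).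

Lemma is_derive_slice1 g t x : differentiable g (t, x) ->
  is_derive t 1 (fun z => g (z, x)) ('d g (t, x) (1, 0)).
Proof.
move=> dg; have E : (fun h : R => h^-1 *: ((((fun z => g (z, x)) \o shift t) (h *: 1)) - g (t, x))) =
    (fun h : R => h^-1 *: ((g \o shift (t, x)) (h *: (1, 0)) - g (t, x))).
  apply/funext => h /=; rewrite (_ : h *: (1, 0) + (t, x) = (h%:A + t, x))//.
  by congr pair; rewrite /= scaler0 add0r.
rewrite -deriveE//; split; last by rewrite /derive E.
by rewrite /derivable E; exact: diff_derivable.
Qed.

Lemma is_derive_slice2 g t x : differentiable g (t, x) ->
  is_derive x 1 (fun z => g (t, z)) ('d g (t, x) (0, 1)).
Proof.
move=> dg; have E : (fun h : R => h^-1 *: ((((fun z => g (t, z)) \o shift x) (h *: 1)) - g (t, x))) =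
    (fun h : R => h^-1 *: ((g \o shift (t, x)) (h *: (0, 1)) - g (t, x))).
  apply/funext => h /=; rewrite (_ : h *: (0, 1) + (t, x) = (t, h%:A + x))//.
  by congr pair; rewrite /= scaler0 add0r.
rewrite -deriveE//; split; last by rewrite /derive E.
by rewrite /derivable E; exact: diff_derivable.
Qed.

Lemma mean_value h (dh : R -> R) x y : (forall z : R, is_derive z 1 h (dh z)) ->
  exists2 z, Num.min x y <= z <= Num.max x y & h y - h x = dh z * (y - x).
Proof.
move=> dh_h.
have ch A : {within A, continuous h}.
  apply: continuous_subspaceT => z; apply: differentiable_continuous.
  by apply/derivable1_diffP; case: (dh_h z).
have [xy|/ltW yx] := leP x y.
  have [z zxy ->] := MVT_segment xy (fun z _ => dh_h z) (ch _).
  by exists z => //; move: zxy; rewrite in_itv.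
have [z zxy E] := MVT_segment yx (fun z _ => dh_h z) (ch _).
exists z; first by move: zxy; rewrite in_itv.
by rewrite -[LHS]opprB E -mulrN opprB.
Qed.

Definition diag_periodic g := forall t x, g (t + 1, x + 1) = g (t, x).

Lemma diag_periodic_diff g v : (forall p, differentiable g p) ->
  diag_periodic g -> diag_periodic (fun p => 'd g p v).
Proof.
move=> dg pg t x; suff dE : 'D_v g (t + 1, x + 1) = 'D_v g (t, x).
  exact: etrans (esym (deriveE v (dg _))) (etrans dE (deriveE v (dg _))).
rewrite /derive.
suff -> : (fun h : R => h^-1 *: ((g \o shift (t + 1, x + 1)) (h *: v) - g (t + 1, x + 1))) =
    (fun h : R => h^-1 *: ((g \o shift (t, x)) (h *: v) - g (t, x))) by [].
apply/funext => h /=; rewrite pg; congr (_ *: (_ - _)).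
case: (h *: v) => a b; rewrite -[RHS]/(g (a + t, b + x)).
by rewrite -[LHS]/(g (a + (t + 1), b + (x + 1))) !addrA pg.
Qed.

(** Diagonal integer translations bring the strip into the compact box [[0, 1] x [- B, 1 + B]]. *)
Lemma diag_periodic_bounded g B : continuous g -> diag_periodic g ->
  exists C, forall t x, `|x - t| <= B -> `|g (t, x)| <= C.
Proof.
move=> cg pg.
have : bounded_set (g @` (`[0, 1]%classic `*` `[- B, 1 + B]%classic)).
  apply: compact_bounded; apply: continuous_compact.
    exact: continuous_subspaceT.
  by apply: compact_setX; exact: segment_compact.
case=> M [_ HM]; exists (M + 1) => t x xt.
have [k /andP[k0 k1]] := int_translate 0 t.
have -> : g (t, x) = g (t + k%:~R, x + k%:~R).
  have := @periodic1_int _ (fun z => g (t + z, x + z)) k 0.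
  by rewrite !add0r !addr0 => -> // z; rewrite !addrA pg.
apply: (HM (M + 1)); first by rewrite ltrDl.
exists (t + k%:~R, x + k%:~R) => //=; rewrite !in_itv/=.
move: xt; rewrite ler_norml => /andP[? ?].
by split; apply/andP; split; lra.
Qed.

Lemma diag_periodic_diff_bounded g v B : C1 g -> diag_periodic g ->
  exists2 C, 0 <= C & forall t x, `|x - t| <= B -> `|'d g (t, x) v| <= C.
Proof.
move=> [dg cg] pg.
have [C HC] := diag_periodic_bounded B (cg v) (diag_periodic_diff v dg pg).
by exists `|C| => // t x /HC /le_trans; apply; exact: ler_norm.
Qed.

Lemma diag_periodic_lipschitz g B : C1 g -> diag_periodic g ->
  exists2 L, 0 <= L & forall t x y, `|x - t| <= B -> `|y - t| <= B ->
    `|g (t, y) - g (t, x)| <= L * `|y - x|.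
Proof.
move=> cg pg; have [L L0 HL] := diag_periodic_diff_bounded (0, 1) B cg pg.
exists L => // t x y xt yt.
have [z zxy ->] := mean_value x y (fun z => is_derive_slice2 (cg.1 (t, z))).
rewrite normrM ler_wpM2r//; apply: HL.
move: xt yt zxy; rewrite !ler_norml minEle maxEle.
by case: ifP => _ /andP[? ?] /andP[? ?] /andP[? ?]; apply/andP; split; lra.
Qed.

End Slices.

Section GeneratingFunctionCost.
Context {R : realType} {F : R * R -> R * R} {S : R * R -> R}.
Hypothesis gf : generating_function F S.

Let S_C2 := gf_C2 gf.

Lemma gf_differentiable p : differentiable S p.
Proof. by case: S_C2 => -[]. Qed.

Lemma gf_partial1 (t x : R) : is_derive t 1 (fun z => S (z, x)) (partial1 S t x).
Proof.
have [H _] := is_derive_slice1 (gf_differentiable (t, x)).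
by rewrite /partial1 derive1E; exact: derivableP.
Qed.

Lemma gf_partial2 (t x : R) : is_derive x 1 (fun z => S (t, z)) (partial2 S t x).
Proof.
have [H _] := is_derive_slice2 (gf_differentiable (t, x)).
by rewrite /partial2 derive1E; exact: derivableP.
Qed.

Lemma gf_partial2E t x : partial2 S t x = 'd S (t, x) (0, 1).
Proof.
have [_ H] := is_derive_slice2 (gf_differentiable (t, x)).
by rewrite /partial2 derive1E.
Qed.

Lemma gf_partial2_bounded B : exists2 L, 0 <= L &
  forall t x, `|x - t| <= B -> `|partial2 S t x| <= L.
Proof.
have [L L0 HL] := diag_periodic_diff_bounded (0, 1) B S_C2.1 (gf_periodic gf).
by exists L => // t x xt; rewrite gf_partial2E; exact: HL.
Qed.

Lemma gf_partial2_lipschitz B : exists2 M, 0 <= M &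
  forall t x y, `|x - t| <= B -> `|y - t| <= B ->
    `|partial2 S t y - partial2 S t x| <= M * `|y - x|.
Proof.
have p2 := diag_periodic_diff (0, 1) gf_differentiable (gf_periodic gf).
have [M M0 HM] := diag_periodic_lipschitz B (S_C2.2 (0, 1)) p2.
by exists M => // t x y xt yt; rewrite !gf_partial2E; exact: HM.
Qed.

(** [partial2 S] is Lipschitz on the strip, so its value at the mean value point differs from that
    at [x] by at most [M * |y - x|]. *)
Lemma gf_semiconcave B : exists2 M, 0 <= M & forall t x y,
  `|x - t| <= B -> `|y - t| <= B ->
  S (t, y) - S (t, x) <= partial2 S t x * (y - x) + M * (y - x) ^+ 2.
Proof.
have [M M0 HM] := gf_partial2_lipschitz B; exists M => // t x y xt yt.
have [z zxy ->] := mean_value x y (gf_partial2 t).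
have zt : `|z - t| <= B.
  move: xt yt zxy; rewrite !ler_norml minEle maxEle.
  by case: ifP => _ /andP[? ?] /andP[? ?] /andP[? ?]; apply/andP; split; lra.
have zx : `|z - x| <= `|y - x|.
  have := ler_norm (y - x); have := ler_norm (x - y); rewrite distrC => ? ?.
  move: zxy; rewrite minEle maxEle ler_norml.
  by case: ifP => _ /andP[? ?]; apply/andP; split; lra.
rewrite -lerBlDl -mulrBl; apply: le_trans (ler_norm _) _.
rewrite normrM -[(y - x) ^+ 2]real_normK ?num_real// expr2 mulrA ler_wpM2r//.
by apply: le_trans (HM _ _ _ xt zt) _; rewrite ler_wpM2l.
Qed.

(* The mixed derivative of S is negative because
   [Theta |-> partial1 S theta Theta] is decreasing. *)
Lemma gf_submodular t t' x x' : t <= t' -> x <= x' ->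
  S (t, x) + S (t', x') <= S (t, x') + S (t', x).
Proof.
move=> tt'; rewrite le_eqVlt => /predU1P[->|xx']; first by rewrite addrC.
have dh (z : R) : is_derive z 1 (fun z => S (z, x) - S (z, x')) (partial1 S z x - partial1 S z x').
  have := gf_partial1 z x; have := gf_partial1 z x' => ? ?; exact: is_deriveB.
have [z _ E] := mean_value t t' dh.
have [dec _] := gf_partial1_diffeo gf z.
have : 0 <= (partial1 S z x - partial1 S z x') * (t' - t).
  by rewrite mulr_ge0 ?subr_ge0// ltW// dec.
move: E; lra.
Qed.

Lemma gf_cost : cost (fun t x => S (t, x)).
Proof.
split.
- exact: gf_periodic gf.
- exact: gf_submodular.
- move=> B; apply: diag_periodic_bounded; last exact: gf_periodic gf.
  by move=> p; apply: differentiable_continuous; apply: gf_differentiable.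
- by move=> B; apply: diag_periodic_lipschitz S_C2.1 (gf_periodic gf).
(* The maximum with 0 excludes [x = t], where the superlinearity quotient would divide by zero. *)
- move=> M; have [B HB] := gf_superlinear gf M; exists (Num.max B 0) => t x.
  rewrite gt_max => /andP[Bx x0].
  by rewrite -ler_pdivlMr//; apply: HB.
- move=> x t; apply: differentiable_continuous; apply/derivable1_diffP.
  by case: (gf_partial1 t x).
Qed.

End GeneratingFunctionCost.

(** * Semiconcave functions *)

Section Derivatives.
Context {R : realType}.
Implicit Types (f w : R -> R) (x y p q : R).

Lemma is_deriveP f x p : is_derive x 1 f p <->
  forall e, 0 < e -> exists2 d, 0 < d & forall y, `|y - x| < d ->
    `|f y - f x - p * (y - x)| <= e * `|y - x|.
Proof.
have E h : h != 0 -> `|p - h^-1 *: (f (h *: 1 + x) - f x)| * `|h| =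
    `|f (h + x) - f x - p * h|.
  move=> h0; rewrite -normrM -normrN /GRing.scale/= mulr1; congr `|_|.
  by field.
split=> [[df fp] e e0|H].
  have : (h^-1 *: ((f \o shift x) (h *: 1) - f x)) @[h --> 0^'] --> p.
    by rewrite -fp; exact: df.
  move=> /cvgrPdist_le/(_ _ e0)/nbhs_ballP[d /= d0 Hd]; exists d => // y yd.
  have [->|yx] := eqVneq y x; first by rewrite !subrr mulr0 subr0 normr0 mulr0.
  have h0 : y - x != 0 by rewrite subr_eq0.
  have := Hd (y - x) _ h0; rewrite /ball/= sub0r normrN => /(_ yd).
  by rewrite -(ler_pM2r (x := `|y - x|)) ?normr_gt0// E// subrK.
have C : (h^-1 *: ((f \o shift x) (h *: 1) - f x)) @[h --> 0^'] --> p.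
  apply/cvgrPdist_le => e e0; have [d d0 Hd] := H _ e0.
  apply/nbhs_ballP; exists d => //= h; rewrite /ball/= sub0r normrN => hd h0.
  rewrite -(ler_pM2r (x := `|h|)) ?normr_gt0// E//.
  by have := Hd (h + x); rewrite addrK; apply.
by split; [exact: cvgP C|exact: cvg_lim C].
Qed.

(** [lo] and [hi] touch at [x], so testing at [x + h] and [x - h] forces equal slopes; [w] is then
    pinched between two functions with the same tangent. *)
Lemma is_derive_squeeze lo hi w x p q : is_derive x 1 lo p -> is_derive x 1 hi q ->
  lo x = w x -> hi x = w x -> (forall y, `|y - x| <= 1 -> lo y <= w y <= hi y) ->
  is_derive x 1 w p.
Proof.
move=> /is_deriveP dlo /is_deriveP dhi lox hix lohi.
have pq : p = q.
  apply/eqP; rewrite -subr_eq0 -normr_le0; apply/ler_addgt0Pr => e e0.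
  have e4 : 0 < e / 4 by lra.
  have [d d0 Hd] := dlo _ e4; have [d' d'0 Hd'] := dhi _ e4.
  pose h := Num.min 1 (Num.min d d' / 2).
  have h0 : 0 < h by rewrite lt_min ltr01 divr_gt0// lt_min d0.
  have [h1 hd hd'] : [/\ h <= 1, h < d & h < d'].
    have hm : h <= Num.min d d' / 2 by rewrite ge_min lexx orbT.
    have : Num.min d d' <= d by rewrite ge_min lexx.
    have : Num.min d d' <= d' by rewrite ge_min lexx orbT.
    by split; [rewrite ge_min lexx|lra|lra].
  have H k : `|k| = h -> (p - q) * k <= e / 2 * h.
    move=> kh; have := lohi (x + k); have := Hd (x + k); have := Hd' (x + k).
    rewrite [x + k]addrC addrK kh => /(_ hd') + /(_ hd) + /(_ h1).
    rewrite !ler_norml. move=> /andP[? ?] /andP[? ?] /andP[? ?]; lra.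
  have H1 := H h (gtr0_norm h0).
  have H2 : (p - q) * - h <= e / 2 * h by apply: H; rewrite normrN gtr0_norm.
  rewrite add0r ler_norml -(ler_pM2r h0) -[X in _ && X](ler_pM2r h0).
  have eh0 := mulr_gt0 e0 h0; apply/andP; split; lra.
subst q; apply/is_deriveP => e e0.
have [d d0 Hd] := dlo _ e0; have [d' d'0 Hd'] := dhi _ e0.
exists (Num.min 1 (Num.min d d')); first by rewrite !lt_min ltr01 d0.
move=> y; rewrite !lt_min => /and3P[/ltW/lohi/andP[lo_w w_hi] /Hd + /Hd'].
rewrite !ler_norml => /andP[? ?] /andP[? ?]; apply/andP; split; lra.
Qed.

Lemma is_derive_affine (g : R -> R) (x p k b : R) : is_derive x 1 g p ->
  is_derive x 1 (fun y => g y + (k * y + b)) (p + k).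
Proof.
move=> /is_deriveP H; apply/is_deriveP => e /H[d d0 Hd]; exists d => // y /Hd.
by congr (`|_| <= _); lra.
Qed.

Lemma is_derive_parabola (x p b K : R) :
  is_derive x 1 (fun y => b + p * (y - x) + K * (y - x) ^+ 2) p.
Proof.
apply/is_deriveP => e e0; have K1 : 0 < `|K| + 1 by rewrite ltr_wpDl.
exists (e / (`|K| + 1)) => [|y]; first by rewrite divr_gt0.
rewrite ltr_pdivlMr// => /ltW yx.
rewrite (_ : _ - _ - _ = K * (y - x) * (y - x)); last by ring.
rewrite normrM ler_wpM2r// normrM.
by have := normr_ge0 (y - x); lra.
Qed.

Definition superdiff (K : R) w x p :=
  forall y, w y - w x - p * (y - x) <= K / 2 * (y - x) ^+ 2.

(* If the lower bound failed at points [y] accumulating at [x] from the right,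
   concavity would propagate the smaller slope [p - e] to the right of them and
   put [p - e] in the superdifferential. *)
Lemma superdiff_unique_right K w x p : 0 <= K -> semiconcave_with K w ->
  superdiff K w x p -> (forall q, superdiff K w x q -> q = p) ->
  forall e, 0 < e -> exists2 d, 0 < d & forall y, x < y -> y < x + d ->
    (p - e) * (y - x) <= w y - w x.
Proof.
move=> K0 scw Pp uniq e e0; apply: contrapT => N.
have {}N d : 0 < d -> exists y, [/\ x < y, y < x + d & w y - w x < (p - e) * (y - x)].
  move=> d0; apply: contrapT => N'; apply: N; exists d => // y xy yd.
  by rewrite leNgt; apply/negP => ?; apply: N'; exists y.
suff /uniq : superdiff K w x (p - e) by lra.
move=> z; have [xz|zx] := ltP x z; last first.
  have := Pp z; have : 0 <= e * (x - z) by rewrite mulr_ge0 ?subr_ge0// ltW.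
  lra.
have zx0 : 0 < z - x by rewrite subr_gt0.
have [y [xy]] := N _ zx0; rewrite addrC subrK => yz wy.
have [r Hr] := scw y; have := Hr x; have := Hr z => rz rx.
have yx0 : 0 < y - x by rewrite subr_gt0.
have rp : r <= p - e + K / 2 * (y - x).
  by rewrite -(ler_pM2r yx0); move: rx wy; rewrite expr2; lra.
have zy0 : 0 <= z - y by rewrite subr_ge0 ltW.
have rp' := ler_wpM2r zy0 rp.
have : K / 2 * ((y - x) * (z - x)) >= 0.
  by rewrite mulr_ge0 ?divr_ge0// mulr_ge0// ltW.
move: rz wy rp'; rewrite !expr2; nra.
Qed.

Lemma superdiff_opp K w x p :
  superdiff K (fun z => w (- z)) (- x) (- p) <-> superdiff K w x p.
Proof.
by split=> H y; have := H (- y); rewrite !opprK !expr2; lra.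
Qed.

(** The supergradient parabola bounds [w] from above; the lower bound is the one-sided lemma on the
    right and, through the reflection [z |-> - z], on the left. *)
Lemma superdiff_unique_derive K w x p : 0 < K -> semiconcave_with K w ->
  superdiff K w x p -> (forall q, superdiff K w x q -> q = p) ->
  is_derive x 1 w p.
Proof.
move=> K0 scw Pp uniq.
have scw' : semiconcave_with K (fun z => w (- z)).
  by move=> z; have [r Hr] := scw (- z); exists (- r) => y; have := Hr (- y); rewrite !expr2; lra.
apply/is_deriveP => e e0.
have [d d0 Hd] := superdiff_unique_right (ltW K0) scw Pp uniq e0.
have [||d' d'0 Hd'] := @superdiff_unique_right K (fun z => w (- z)) (- x) (- p) (ltW K0) scw' _ _ _ e0.
- exact/superdiff_opp.
- move=> q Pq; rewrite -(uniq (- q)) ?opprK//; apply/superdiff_opp.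
  by rewrite opprK.
pose d3 := e * 2 / K.
have d30 : 0 < d3 by rewrite divr_gt0// mulr_gt0.
exists (Num.min d3 (Num.min d d')); first by rewrite !lt_min d30 d0.
move=> y; rewrite !lt_min => /and3P[y3 yd yd'].
rewrite ler_norml; apply/andP; split; last first.
  apply: le_trans (Pp y) _.
  rewrite -[_ ^+ 2]real_normK ?num_real// expr2 mulrA ler_wpM2r//.
  by move: (ltW y3); rewrite /d3 ler_pdivlMr//; lra.
case: (ltgtP x y) => [xy|yx|<-]; last by rewrite !subrr mulr0 subrr normr0 mulr0 oppr0.
- move: yd; rewrite gtr0_norm ?subr_gt0// => yd.
  by have := Hd y xy; rewrite -ltrBlDl => /(_ yd); lra.
- move: yd'; rewrite ltr0_norm ?subr_lt0// => yd'.
  have := Hd' (- y); rewrite ltrN2 !opprK => /(_ yx).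
  by rewrite -ltrBlDl opprK => /(_ _); rewrite (_ : - y + x = - (y - x)); [move=> /(_ yd'); lra|lra].
Qed.

(** Subtracting the parabola [K / 2 * x ^+ 2] turns [p] and [q] into supergradients in the concave
    sense, [p - K * x] and [q - K * y], which decrease. *)
Lemma superdiff_monotone K w x y p q : x < y -> superdiff K w x p ->
  superdiff K w y q -> q - K * y <= p - K * x.
Proof.
move=> xy /(_ y) Hp /(_ x) Hq.
have yx : 0 < y - x by rewrite subr_gt0.
by rewrite -(ler_pM2r yx); move: Hp Hq; rewrite !expr2; lra.
Qed.

(** At a point of non-differentiability two supergradients span an interval. After the shift by
    [K * x] these intervals are disjoint for distinct points, so choosing a rational in each is
    injective. *)
Lemma semiconcave_countable_nonderivable K w : 0 < K -> semiconcave_with K w ->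
  countable [set x | ~ derivable w x 1].
Proof.
move=> K0 scw.
have H x : ~ derivable w x 1 -> exists r : rat, exists p q,
    [/\ superdiff K w x p, superdiff K w x q, p - K * x < ratr r & ratr r < q - K * x].
  move=> nd; have [p Pp] := scw x.
  have [q [Pq qp]] : exists q, superdiff K w x q /\ q <> p.
    apply: contrapT => N; apply: nd.
    have [//] : is_derive x 1 w p; apply: superdiff_unique_derive Pp _ => // q Pq.
    by apply: contrapT => qp; apply: N; exists q.
  have /eqP := qp; rewrite neq_lt => /orP[]lt.
  - have [r] := @rat_in_itvoo _ (q - K * x) (p - K * x) (ltac:(lra)).
    by rewrite in_itv/= => /andP[? ?]; exists r, q, p.
  - have [r] := @rat_in_itvoo _ (p - K * x) (q - K * x) (ltac:(lra)).
    by rewrite in_itv/= => /andP[? ?]; exists r, p, q.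
have /boolp.choice[r Hr] x : exists r : rat, ~ derivable w x 1 -> exists p q,
    [/\ superdiff K w x p, superdiff K w x q, p - K * x < ratr r & ratr r < q - K * x].
  have [nd|d] := pselect (~ derivable w x 1); last by exists 0.
  by have [r Hr] := H x nd; exists r.
apply/countable_injP; exists (pickle \o r) => x y; rewrite !inE/= => nx ny.
move=> /(pcan_inj pickleK) rxy.
have [p [q [Pp Pq p1 q1]]] := Hr _ nx; have [p' [q' [Pp' Pq' p2 q2]]] := Hr _ ny.
rewrite rxy in p1 q1.
case: (ltgtP x y) => // xy.
- by have := superdiff_monotone xy Pp Pq'; lra.
- by have := superdiff_monotone xy Pp' Pq; lra.
Qed.

End Derivatives.

(** * Weak K.A.M. solutions *)

Section CircleFunctions.
Context {R : realType}.
Implicit Types (w : R -> R) (v : circle R -> R).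

(** The representative chosen by [repr] is immaterial only for periodic [w]; continuity then comes
    from the quotient topology. *)
Definition circle_descend w : circle R -> R := fun q => w (repr q).

Lemma circle_pi_repr (q : circle R) : circle_pi (repr q) = q.
Proof. exact: reprK. Qed.

Lemma circle_descendK w : periodic1 w -> circle_lift (circle_descend w) = w.
Proof.
move=> pw; apply/funext => x; rewrite /circle_lift /circle_descend.
have /circle_piP/intrP[k E] := circle_pi_repr (circle_pi x).
by rewrite -(periodic1_int k x pw) -E addrC subrK.
Qed.

Lemma circle_descend_continuous w : periodic1 w -> continuous w ->
  continuous (circle_descend w).
Proof.
move=> pw cw; apply/quotient_continuous.
by rewrite [X in continuous X](circle_descendK pw).
Qed.

Lemma circle_lift_periodic v : periodic1 (circle_lift v).
Proof.
move=> x; congr v; apply/circle_piP.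
by rewrite addrAC subrr add0r.
Qed.

Lemma circle_lift_continuous v : continuous v -> continuous (circle_lift v).
Proof. by move/quotient_continuous. Qed.

Lemma periodic1_bounded w : periodic1 w -> continuous w ->
  exists C, forall x, `|w x| <= C.
Proof.
move=> pw cw; have [|t x|C HC] := @diag_periodic_bounded _ (w \o snd) 0.
- by move=> p; apply: continuous_comp; [exact: cvg_snd|exact: cw].
- exact: pw.
by exists C => x; apply: (HC x x); rewrite subrr normr0.
Qed.

Lemma is_derive_periodic w (x p : R) (k : int) : periodic1 w ->
  is_derive x 1 w p -> is_derive (x + k%:~R) 1 w p.
Proof.
move=> pw /is_deriveP H; apply/is_deriveP => e /H[d d0 Hd]; exists d => // y yd.
have wy : w (y - k%:~R) = w y by rewrite -(periodic1_int k _ pw) subrK.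
have := Hd (y - k%:~R); rewrite wy (periodic1_int k x pw).
by rewrite (_ : y - _ - x = y - (x + k%:~R)); [apply|lra].
Qed.

End CircleFunctions.

Section WeakKAM.
Context {R : realType} {S : R * R -> R} {c : R}.

Lemma weak_KAM_equation_le a v t x : weak_KAM_equation S c a v ->
  circle_lift v x <= circle_lift v t + S (t, x) + c * (t - x) + a.
Proof. by move=> [_ H]; rewrite -lee_fin H; apply: ereal_inf_lbound; exists t. Qed.

Lemma weak_KAM_equation_approx a v x e : weak_KAM_equation S c a v -> 0 < e ->
  exists t, circle_lift v t + S (t, x) + c * (t - x) + a < circle_lift v x + e.
Proof.
move=> [_ H] e0; apply: contrapT => N.
suff : ((circle_lift v x + e)%:E <= (circle_lift v x)%:E)%E by rewrite lee_fin; lra.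
rewrite [X in (_ <= X)%E]H; apply: le_ereal_inf_tmp => _ [t _ <-].
by rewrite lee_fin leNgt; apply/negP => ?; apply: N; exists t.
Qed.

(** From an almost maximum [x] of [w - w'], stepping to an almost minimizer [t] of the primed
    equation raises [w - w'] by at least [a' - a], up to a small error; the supremum leaves no room
    for a positive gain. *)
Lemma weak_KAM_constant_le a a' v v' :
  weak_KAM_equation S c a v -> weak_KAM_equation S c a' v' -> a' <= a.
Proof.
move=> Hv Hv'; set w := circle_lift v; set w' := circle_lift v'.
have [C HC] := periodic1_bounded (circle_lift_periodic v) (circle_lift_continuous Hv.1).
have [C' HC'] := periodic1_bounded (circle_lift_periodic v') (circle_lift_continuous Hv'.1).
pose E := range (fun x => w x - w' x).
have Eub : has_sup E.
  split; first by exists (w 0 - w' 0), 0.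
  exists (C + C') => _ [x _ <-]; have := HC x; have := HC' x.
  by rewrite !ler_norml -/w -/w' => /andP[? ?] /andP[? ?]; lra.
rewrite -(lerD2l (sup E)).
apply/ler_addgt0Pr => e e0; have e2 : 0 < e / 2 by lra.
have [_ [x _ <-] xE] := sup_adherent e2 Eub.
have [t Ht] := weak_KAM_equation_approx x Hv' e2.
have := weak_KAM_equation_le t x Hv.
have : w t - w' t <= sup E by apply: ub_le_sup; [case: Eub|exists t].
move: xE Ht; rewrite -/w -/w'; lra.
Qed.

Lemma weak_KAM_equation_alpha a v : weak_KAM_equation S c a v -> is_alpha S c a.
Proof.
move=> Hv; split; first by exists v.
move=> a' [v' Hv']; apply/eqP; rewrite eq_le.
by rewrite (weak_KAM_constant_le Hv Hv') (weak_KAM_constant_le Hv' Hv).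
Qed.

Lemma calibrated_weak_KAM a w : periodic1 w -> continuous w ->
  calibrated (fun t x => S (t, x)) c a w ->
  weak_KAM_solution S c (circle_descend w).
Proof.
move=> pw cw cal.
suff H : weak_KAM_equation S c a (circle_descend w).
  by exists a => //; exact: weak_KAM_equation_alpha H.
split; first exact: circle_descend_continuous.
move=> x; rewrite circle_descendK//; have [Hle [t Ht]] := cal x.
apply/eqP; rewrite eq_le; apply/andP; split.
  apply: le_ereal_inf_tmp => _ [z _ <-]; rewrite lee_fin.
  by have := Hle z; rewrite /action mul1r.
apply: ereal_inf_lbound; exists t => //.
by rewrite Ht /action mul1r.
Qed.

End WeakKAM.

(** * Semi-concavity and backward invariance of calibrated functions *)

Section CalibratedFunctions.
Context {R : realType} {F : R * R -> R * R} {S : R * R -> R}.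
Hypothesis gf : generating_function F S.
Context {c a : R} {w : R -> R}.
Hypothesis w_cal : calibrated (fun t x => S (t, x)) c a w.
Hypothesis w_per : periodic1 w.

Let calE t x : action (fun t x => S (t, x)) 1 c w t x + a =
  w t + S (t, x) + c * (t - x) + a.
Proof. by rewrite /action mul1r. Qed.

(** For a minimizer [t], [w] lies below a function of [y] built on [S (t, y)] and touches it at [x],
    which gives semi-concavity near [x]; beyond distance 1 the Lipschitz bound suffices, as
    [|y - x| <= (y - x) ^+ 2]. *)
Lemma calibrated_semiconcave L : (forall x y, `|w y - w x| <= L * `|y - x|) ->
  exists2 K, 0 < K & semiconcave_with K w.
Proof.
move=> wL; have [B B0 HB] := action_confined (gf_cost gf) c.
have [M M0 HM] := gf_semiconcave gf (B + 1).
have [N N0 HN] := gf_partial2_bounded gf (B + 1).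
have L0 : 0 <= L by apply: le_trans (normr_ge0 _) _; have := wL 0 1; rewrite subr0 normr1 mulr1; apply.
(* [M] serves the near points and [L + N + |c|] the far ones, where [N + |c|] bounds the slope [p];
   1 ensures positivity and 2 cancels the half in [K / 2]. *)
exists ((M + L + N + `|c| + 1) * 2) => [|x].
  by rewrite mulr_gt0// ltr_wpDl// !addr_ge0.
rewrite mulfK//.
have [_ [t0 Ht0]] := w_cal x; have [t xt Ht] := HB 1 w t0 x w_per.
have wx : w t + S (t, x) + c * (t - x) + a <= w x.
  by rewrite Ht0 -calE lerD2r.
have xt1 : `|x - t| <= B + 1 by apply: le_trans xt _; rewrite lerDl.
pose p := partial2 S t x - c; exists p => y.
have sq : 0 <= (y - x) ^+ 2 by exact: sqr_ge0.
have [yx|/ltW yx] := leP `|y - x| 1.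
  have yt1 : `|y - t| <= B + 1.
    rewrite (_ : y - t = (x - t) + (y - x)); last by lra.
    by apply: le_trans (ler_normD _ _) _; rewrite lerD.
  have := HM _ _ _ xt1 yt1; have [/(_ t) + _] := w_cal y; rewrite calE.
  have := mulr_ge0 L0 sq; have := mulr_ge0 N0 sq; have := mulr_ge0 (normr_ge0 c) sq.
  rewrite /p; lra.
have pN : `|p| <= N + `|c|.
  by apply: le_trans (ler_normB _ _) _; rewrite lerD2r HN.
have py : - (p * (y - x)) <= (N + `|c|) * `|y - x|.
  by apply: le_trans (ler_norm _) _; rewrite normrN normrM ler_wpM2r.
have wy : w y - w x <= L * `|y - x| by apply: le_trans (ler_norm _) (wL x y).
have yx2 : `|y - x| <= (y - x) ^+ 2.
  by rewrite -[leRHS]real_normK ?num_real// expr2 -[leLHS]mulr1 ler_wpM2l.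
have := ler_wpM2l L0 yx2; have := ler_wpM2l (addr_ge0 N0 (normr_ge0 c)) yx2.
have := mulr_ge0 M0 sq; lra.
Qed.

(** Calibration makes [w] touch [hi] from below at [x], so the two slopes agree. *)
Lemma calibrated_derive (x p t : R) : is_derive x 1 w p ->
  w x = w t + S (t, x) + c * (t - x) + a -> p = partial2 S t x - c.
Proof.
move=> wp wx.
pose hi y := S (t, y) + ((- c) * y + (w t + c * t + a)).
have dhi : is_derive x 1 hi (partial2 S t x - c).
  by apply: is_derive_affine; exact: (gf_partial2 gf).
have [_ <-] : is_derive x 1 hi p; last by case: dhi.
apply: (is_derive_squeeze wp dhi) => // [|y _]; first by rewrite wx /hi; lra.
by rewrite lexx andbT; have [/(_ t) + _] := w_cal y; rewrite calE /hi; lra.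
Qed.

(** Differentiability is a conclusion here: calibration bounds [w] below by a differentiable
    function, semi-concavity bounds it above by a parabola, and both touch [w] at [t]. *)
Lemma calibrated_minimizer_derive (K x t : R) : semiconcave_with K w ->
  w x = w t + S (t, x) + c * (t - x) + a ->
  is_derive t 1 w (- partial1 S t x - c).
Proof.
move=> scw wx; have [p Hp] := scw t.
pose lo z := - S (z, x) + ((- c) * z + (w x + c * x - a)).
have dlo : is_derive t 1 lo (- partial1 S t x - c).
  apply: is_derive_affine; have H := gf_partial1 gf t x; exact: is_deriveN.
apply: (is_derive_squeeze dlo (is_derive_parabola t p (w t) (K / 2))).
- by rewrite /lo wx; lra.
- by rewrite subrr expr2 !mulr0 !addr0.
move=> z _; have := Hp z; have [/(_ z) + _] := w_cal x; rewrite calE /lo.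
by move=> ? ?; apply/andP; split; lra.
Qed.

(** If [(x1, r1)] is the image, a minimizer [t] for [x1] satisfies [partial2 S t x1 = r1], so by
    injectivity it is the abscissa of the preimage; the derivative of [w] at this minimizer puts the
    preimage on the graph. *)
Lemma calibrated_backward_invariant f K : is_lift f F -> semiconcave_with K w ->
  f @^-1` partial_graph c (circle_descend w) `<=` partial_graph c (circle_descend w).
Proof.
move=> [_ fF] scw [q r] [x]; rewrite circle_descendK// => dw.
rewrite -{1}(circle_pi_repr q) -[(_, r)]/(annulus_pi (repr q, r)) -fF.
case E : (F (repr q, r)) => [x1 r1] [/circle_piP/intrP[k x1x] r1E].
have /(gf_generates gf)[rE r1E'] := E.
have dw1 : is_derive x1 1 w (derive1 w x).
  rewrite (_ : x1 = x + k%:~R); last by lra.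
  by apply: is_derive_periodic => //; rewrite derive1E; exact: derivableP.
have [_ [t]] := w_cal x1; rewrite calE => wt.
have tq : t = repr q.
  have [dec _] := gf_partial2_diffeo gf x1.
  have /eqP := calibrated_derive dw1 wt; rewrite -subr_eq0 => /eqP px.
  have ptq : partial2 S t x1 = partial2 S (repr q) x1 by lra.
  by case: (ltgtP t (repr q)) => // /dec; rewrite ptq ltxx.
have [dt wt'] := calibrated_minimizer_derive scw wt.
exists t; first by rewrite circle_descendK.
rewrite circle_descendK// derive1E wt' tq circle_pi_repr; congr pair.
by rewrite rE; lra.
Qed.

End CalibratedFunctions.

(** Comparing [z] in a period with 0 and 1, where both functions vanish, places [w' z - w z] between
    [- (c' - c) * z] and [(c' - c) * (1 - z)]. *)
Lemma vertically_ordered_dist (R : realType) (w w' : R -> R) (c c' : R) :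
  periodic1 w -> periodic1 w' -> w 0 = 0 -> w' 0 = 0 -> c <= c' ->
  vertically_ordered c w c' w' -> forall x, `|w' x - w x| <= c' - c.
Proof.
move=> pw pw' w0 w0' cc' ww' x; have [k /andP[k0 /ltW k1]] := int_translate 0 x.
rewrite -(periodic1_int k x pw) -(periodic1_int k x pw').
move: (x + k%:~R) k0 k1 => z; rewrite subr0 => z0 z1.
have := ww' _ _ z0; have := ww' _ _ z1.
have -> : w 1 = 0 by have := pw 0; rewrite add0r w0.
have -> : w' 1 = 0 by have := pw' 0; rewrite add0r w0'.
rewrite w0 w0'; have cz : 0 <= (c' - c) * z by rewrite mulr_ge0 ?subr_ge0.
have cz' : 0 <= (c' - c) * (1 - z) by rewrite mulr_ge0 ?subr_ge0.
by move=> ? ?; rewrite ler_norml; apply/andP; split; lra.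
Qed.

(** Inserting the value at [(p.1, c)] separates the variables: the Lipschitz bound in the class is
    uniform in the angle. *)
Lemma circle_family_continuous (R : realType) (v : R -> R -> R) :
  (forall c, continuous (circle_descend (v c))) ->
  (forall c c' x, `|v c' x - v c x| <= `|c' - c|) ->
  continuous (fun p : circle R * R => circle_descend (v p.2) p.1).
Proof.
move=> cv dv [q c]; apply/cvgrPdist_le => /= e e0.
have e2 : 0 < e / 2 by lra.
have N1 : \forall p \near (q, c), `|circle_descend (v c) q - circle_descend (v c) p.1| <= e / 2.
  have : (fun p : circle R * R => circle_descend (v c) p.1) @ (q, c) --> circle_descend (v c) q.
    by apply: (cvg_comp _ _ cvg_fst); exact: cv.
  by move=> /cvgrPdist_le/(_ _ e2).
have N2 : \forall p \near (q, c), `|c - p.2| <= e / 2.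
  have : (fun p : circle R * R => p.2) @ (q, c) --> c by exact: cvg_snd.
  by move=> /cvgrPdist_le/(_ _ e2).
apply: filterS2 N1 N2 => p H1 H2.
rewrite (_ : circle_descend (v c) q - circle_descend (v p.2) p.1 =
  (circle_descend (v c) q - circle_descend (v c) p.1) +
  (circle_descend (v c) p.1 - circle_descend (v p.2) p.1)); last by lra.
apply: le_trans (ler_normD _ _) _; rewrite (splitr e).
by apply: lerD => //; exact: le_trans (dv _ _ _) H2.
Qed.

Theorem theorem1p1 (R : realType) (f : annulus R -> annulus R)
    (F : R * R -> R * R) (S : R * R -> R) :
  symplectic_twist f ->
  is_lift f F ->
  generating_function F S ->
  exists u : circle R * R -> R,
    [/\ continuous u,
        forall c : R, u (circle_pi 0, c) = 0
      & forall c : R,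
          [/\ weak_KAM_solution S c (fun theta => u (theta, c)),
              circle_semiconcave (fun theta => u (theta, c)),
              circle_ae_differentiable (fun theta => u (theta, c))
            & f @^-1` partial_graph c (fun theta => u (theta, c)) `<=`
              partial_graph c (fun theta => u (theta, c))]].
Proof.
move=> _ fF gf; have [v [a [v0 vord vlip vcal]]] := ordered_calibrated_solutions (gf_cost gf).
have pv c : periodic1 (v c) by case: (v0 c).
have z0 c : v c 0 = 0 by case: (v0 c).
have cv c : continuous (v c).
  have [L HL] := vlip c => x; apply/cvgrPdist_le => e e0.
  have L1 : 0 < `|L| + 1 by rewrite ltr_wpDl.
  near=> y; apply: le_trans (HL _ _) _; apply: (@le_trans _ _ ((`|L| + 1) * `|x - y|)).
    by rewrite ler_wpM2r//; have := ler_norm L; lra.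
  rewrite mulrC -ler_pdivlMr//; near: y.
  by apply: cvgr_dist_le; [exact: cvg_id|rewrite divr_gt0].
exists (fun p => circle_descend (v p.2) p.1); split=> [|c|c].
- apply: circle_family_continuous => [c|c c' x]; first exact: circle_descend_continuous.
  have [cc'|/ltW c'c] := leP c c'.
    rewrite [leRHS]ger0_norm ?subr_ge0//.
    exact: vertically_ordered_dist (pv _) (pv _) (z0 _) (z0 _) cc' (vord _ _ cc') x.
  rewrite distrC [leRHS]distrC [leRHS]ger0_norm ?subr_ge0//.
  exact: vertically_ordered_dist (pv _) (pv _) (z0 _) (z0 _) c'c (vord _ _ c'c) x.
- by rewrite /= -[LHS]/(circle_lift (circle_descend (v c)) 0) circle_descendK.
rewrite -[fun theta => _]/(circle_descend (v c)).
have [L HL] := vlip c.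
have [K K0 scK] := calibrated_semiconcave gf (vcal c) (pv c) HL.
split.
- exact: calibrated_weak_KAM (vcal c).
- by exists K => //; rewrite circle_descendK.
- rewrite /circle_ae_differentiable circle_descendK//.
  have cN := semiconcave_countable_nonderivable K0 scK.
  exists [set x | ~ derivable (v c) x 1]; split=> //.
    exact: countable_measurable.
  exact: countable_lebesgue_measure0.
- exact: calibrated_backward_invariant (vcal c) (pv c) _ _ fF scK.
Unshelve. all: by end_near. Qed.
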